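(* Let $D$ be a locally semicomplete digraph. Then $D$ is semi-strict chordal if and only if $S(D)$ is semi-strict chordal and $D$ does not contain as an induced subdigraph a directed cycle consisting of non-symmetric arcs, or a digraph in the family $\mathcal{F}_1$ (types (a)--(d)), or a digraph in the family $\mathcal{F}_2$.
   Context: Digraphs are finite with at least one vertex, have no loops and no multiple arcs, but may contain digons (pairs of arcs joining two vertices in opposite directions). An arc contained in a digon is symmetric; otherwise it is non-symmetric. Two vertices are adjacent if there is at least one arc between them. $N^-(v)$, $N^+(v)$ denote the sets of in-neighbours and out-neighbours of $v$ (counting both symmetric and non-symmetric arcs). A vertex $v$ of a digraph $D$ is semi-strict di-simplicial if for any $u\in N^-(v)$ and $w\in N^+(v)$ with $u\neq w$, both $uw$ and $wu$ are arcs of $D$. A digraph is semi-strict chordal if every induced subdigraph of it contains a semi-strict di-simplicial vertex. $S(D)$ is the spanning subdigraph of $D$ whose arc set consists of all symmetric arcs of $D$. A digraph is semicomplete if any two vertices are adjacent. $D$ is locally semicomplete if for every vertex $v$, each of $N^-(v)$ and $N^+(v)$ induces a semicomplete subdigraph of $D$. In the following, ''$x\to y$'' means $xy$ is an arc and $yx$ is not; ''$x\leftrightarrow y$'' means both $xy$ and $yx$ are arcs; ''$x,y$ joined by a single arc'' means exactly one of $xy,yx$ is an arc, with unspecified direction. Family $\mathcal{F}_1$: (a) Vertices $1,2,3,4$ with $1\leftrightarrow 3$, $2\leftrightarrow 4$; $1,2$ joined by a single arc; $3,4$ joined by a single arc; $2,3$ adjacent in any way (single arc in either direction or digon); $4,1$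 adjacent in any way. (b) Vertices $1,2,3,4$ with $1\leftrightarrow 4$, $1\leftrightarrow 3$, $2\to 3$, $4\to 3$, $4\to 2$, and $1,2$ joined by a single arc. (c) Vertices $1,2,3,4$ with $3\leftrightarrow 4$, $2\to 3$, $4\to 1$, $1\to 3$, $4\to 2$, and $1,2$ joined by a single arc. (d) Vertices $1,2,3$ with $1\to 2$, $2\to 3$, $3\to 1$. Every digraph obtained by any choice of the unspecified adjacencies belongs to $\mathcal{F}_1$. Family $\mathcal{F}_2$: for each integer $k\ge 1$, the digraph with vertices $v_1,v_2,u_1,\dots,u_k,w_1,w_2$ in which $v_1\leftrightarrow v_2$, $v_1\to u_1$, $v_2\to u_1$, $u_i\to u_{i+1}$ for $1\le i<k$, $u_k\to w_1$, $u_k\to w_2$, $w_1\leftrightarrow w_2$, and there are no other arcs. *)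

(* Defs.v *)
From mathcomp Require Import all_boot.

Set Implicit Arguments.
Unset Strict Implicit.
Unset Printing Implicit Defensive.

(* Finite, nonempty, loopless; no multiple arcs since [arc] is a relation.
   Digons are allowed. *)
Record digraph := Digraph {
  vertex :> finType;
  arc : rel vertex;
  arc_irr : irreflexive arc;
  vertex_gt0 : 0 < #|vertex|
}.
Arguments arc {d}.

Section Induced.
Variables (D : digraph) (A : {set D}) (hA : A != set0).

Definition induced_arc : rel {x : D | x \in A} :=
  fun x y => arc (val x) (val y).

Lemma induced_arc_irr : irreflexive induced_arc.
Proof. by move=> x; apply: arc_irr. Qed.

Lemma induced_gt0 : 0 < #|{: {x : D | x \in A}}|.
Proof. by rewrite card_sig card_gt0. Qed.

Definition induced : digraph := Digraph induced_arc_irr induced_gt0.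

End Induced.

(* Families of digraphs are predicates closed under isomorphism, so containing
   an induced copy of a member of F means that some vertex set induces a
   digraph satisfying F. *)
Definition contains_induced (F : digraph -> Prop) (D : digraph) : Prop :=
  exists (A : {set D}) (hA : A != set0), F (induced hA).

Section Arcs.
Variable D : digraph.
Implicit Types (x y v : D).

Definition in_nbh v : {set D} := [set u | arc u v].
Definition out_nbh v : {set D} := [set w | arc v w].

Definition adjacent x y := arc x y || arc y x.
Definition digon x y := arc x y && arc y x.
Definition to x y := arc x y && ~~ arc y x.
Definition single_arc x y := arc x y (+) arc y x.

Definition semi_strict_di_simplicial v : Prop :=
  forall u w, u \in in_nbh v -> w \in out_nbh v -> u != w ->
    arc u w /\ arc w u.

Lemma digon_irr : irreflexive digon.
Proof. by move=> x; rewrite /digon arc_irr. Qed.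

(* S(D) *)
Definition symmetric_part : digraph := Digraph digon_irr (vertex_gt0 D).

Definition semicomplete : Prop := forall x y, x != y -> adjacent x y.

End Arcs.

Definition semi_strict_chordal (D : digraph) : Prop :=
  forall (A : {set D}) (hA : A != set0),
    exists v : induced hA, semi_strict_di_simplicial v.

(* Digraphs are nonempty, so an empty neighbourhood imposes no condition. *)
Definition locally_semicomplete (D : digraph) : Prop :=
  forall v : D,
    (forall h : in_nbh v != set0, semicomplete (induced h)) /\
    (forall h : out_nbh v != set0, semicomplete (induced h)).

(* s lists every vertex of H exactly once. *)
Definition lists_vertices (H : digraph) (s : seq H) : Prop :=
  perm_eq s (enum H).

Definition directed_cycle (H : digraph) : Prop :=
  exists s : seq H,
    [/\ lists_vertices s, 1 < size s & forall x y, arc x y = (next s x == y)].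

Definition nonsymmetric_directed_cycle (H : digraph) : Prop :=
  directed_cycle H /\ forall x y : H, arc x y -> ~~ arc y x.

Definition F1a (H : digraph) : Prop :=
  exists x1 x2 x3 x4 : H, lists_vertices [:: x1; x2; x3; x4] /\
    [&& digon x1 x3, digon x2 x4, single_arc x1 x2, single_arc x3 x4,
        adjacent x2 x3 & adjacent x4 x1].

Definition F1b (H : digraph) : Prop :=
  exists x1 x2 x3 x4 : H, lists_vertices [:: x1; x2; x3; x4] /\
    [&& digon x1 x4, digon x1 x3, to x2 x3, to x4 x3, to x4 x2
      & single_arc x1 x2].

Definition F1c (H : digraph) : Prop :=
  exists x1 x2 x3 x4 : H, lists_vertices [:: x1; x2; x3; x4] /\
    [&& digon x3 x4, to x2 x3, to x4 x1, to x1 x3, to x4 x2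
      & single_arc x1 x2].

Definition F1d (H : digraph) : Prop :=
  exists x1 x2 x3 : H, lists_vertices [:: x1; x2; x3] /\
    [&& to x1 x2, to x2 x3 & to x3 x1].

Definition F1 (H : digraph) : Prop := [\/ F1a H, F1b H, F1c H | F1d H].

(* The path u_1, ..., u_k with k >= 1 is the sequence u1 :: us, whose
   consecutive pairs are zip (u1 :: us) us and whose end u_k is last u1 us. *)
Definition F2 (H : digraph) : Prop :=
  exists (v1 v2 u1 : H) (us : seq H) (w1 w2 : H),
    let uk := last u1 us in
    lists_vertices ([:: v1; v2] ++ (u1 :: us) ++ [:: w1; w2]) /\
    forall x y : H, arc x y =
      ((x, y) \in [:: (v1, v2); (v2, v1); (v1, u1); (v2, u1)]
                    ++ zip (u1 :: us) us
                    ++ [:: (uk, w1); (uk, w2); (w1, w2); (w2, w1)]).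

(* Main.v *)
Require Import Defs.
From mathcomp Require Import all_boot.
From Stdlib Require Import Classical.
(* Both path.v and the digraphs have an [arc]; the latter is the one meant. *)
Import Defs.

(** Call a vertex good when it is semi-strict di-simplicial, and write N(x) for the
    set of vertices joined to x by a digon, that is, for the neighbourhood of x in
    S(D).

    Necessity.  A good vertex of D[A] is still good in S(D)[A], and no digraph of
    the forbidden families has a good vertex: each of its vertices has an
    in-neighbour and an out-neighbour that no digon joins.

    Sufficiency.  The right-hand side is inherited by induced subdigraphs
    ([tame_induced]), so it is enough to find one good vertex ([tame_good]).  The
    family (a) of F1 says that N(a) and N(b) are comparable whenever a single arc
    joins a and b ([digon_nbh_comparable]).  Hence a single arc between different
    components of S(D) has an end on no digon; such a vertex x is called isolated.

    If some nonempty set B is closed under adjacency and all its vertices are on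
    digons ([closed_set_good]), choose v in B simplicial in S(D) with N(v) as small
    as possible, and let W be the set of the vertices b with N(b) = N(v).  It induces
    a transitive tournament, and (b) and (c) show that its source or its sink is
    good.

    In general, an isolated vertex x adjacent to one vertex of a nontrivial component
    C of S(D) is adjacent to all of C.  Unless both kinds of arcs between x and C
    occur (x is mixed), C looks like a single vertex from x.  The skeleton keeps one
    vertex of each nontrivial component of S(D), and the isolated vertices that are
    not mixed.  It contains no digon, and it is acyclic because a shortest directed
    cycle in it would be induced ([skeleton_acyclic]).  Let s be a source of the
    skeleton.
    - If s is isolated, then nothing dominates s in D ([skeleton_in]), so s is good.
    - If s stands for a component C and has no neighbour in the skeleton, then either
      C is closed under adjacency, and the previous case applies, or a mixed vertex is
      attached to C, and that vertex is good ([isolated_rep_good]).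
    - Otherwise follow the skeleton from s to a sink t.  If t is isolated, it
      dominates nothing and is good.  If not, some skeleton path joins the
      representatives of two nontrivial components; a shortest one is induced, and a
      digon at each of its ends completes it to a member of F2
      ([no_skeleton_path]). *)

Set Implicit Arguments.
Unset Strict Implicit.
Unset Printing Implicit Defensive.

(** * Paths in acyclic relations *)

Lemma zip_rcons_path (T : Type) (x w : T) p :
  zip (x :: rcons p w) (rcons p w) = zip (x :: p) p ++ [:: (last x p, w)].
Proof. by elim: p x => //= y p IH x; rewrite -IH. Qed.

Lemma zip_map (S T : Type) (f : S -> T) p q :
  zip (map f p) (map f q) = map (fun e => (f e.1, f e.2)) (zip p q).
Proof. by elim: p q => [|x p IH] [|y q] //=; rewrite IH. Qed.

Lemma next_map_in (S T : eqType) (f : S -> T) s x :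
  {in s &, injective f} -> x \in s -> next (map f s) (f x) = f (next s x).
Proof.
case: s => // y0 p; rewrite /next /= => injf sx.
have {}injf z : z \in y0 :: p -> (f x == f z) = (x == z).
  by move=> sz; apply/eqP/eqP => [|->//]; apply: injf.
move: {1 3 5}y0 injf {sx} => y.
elim: p y => [|z p IH] y injf /=; rewrite injf ?mem_head //; first by case: ifP.
by case: ifP => // _; apply: IH => t pt; rewrite injf // in_cons pt orbT.
Qed.

Section Acyclic.
Variables (T : eqType) (r : rel T).

Lemma mem_zip_path x p a b :
  reflect (exists p1 p2 : seq T, p = p1 ++ b :: p2 /\ last x p1 = a)
    ((a, b) \in zip (x :: p) p).
Proof.
elim: p x => [|y p IH] x.
  by right => -[[|? ?] [p2 []]].
rewrite -[zip _ _]/((x, y) :: zip (y :: p) p) in_cons xpair_eqE; apply: (iffP orP).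
  case=> [/andP[/eqP-> /eqP->]|/IH[p1 [p2 [-> <-]]]]; first by exists [::], p.
  by exists (y :: p1), p2.
move=> [[|y' p1] [p2 [[-> pE] /= lE]]]; first by left; rewrite lE !eqxx.
by right; apply/IH; exists p1, p2.
Qed.

Lemma index_zip_path (x : T) (p : seq T) (a b : T) : uniq (x :: p) ->
  (a, b) \in zip (x :: p) p -> index b (x :: p) = (index a (x :: p)).+1.
Proof.
move=> up /mem_zip_path[p1 [p2 [pE <-]]]; move: up; rewrite pE -cat_cons.
set l := x :: p1 => ul.
have -> : index b (l ++ b :: p2) = size l.
  by rewrite index_cat /= eqxx addn0; move: ul; rewrite cat_uniq /= => /and3P[_ /norP[/negPf->]].
rewrite index_cat mem_last index_last //.
by move: ul; rewrite cat_uniq => /andP[].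
Qed.

Lemma path_zip x p a b : path r x p -> (a, b) \in zip (x :: p) p -> r a b.
Proof.
move=> rp /mem_zip_path[p1 [p2 [pE <-]]]; move: rp.
by rewrite pE cat_path /= => /and3P[].
Qed.

Hypothesis acyclic : forall s, cycle r s -> s = [::].

Lemma acyclic_path x p : path r x p -> p != [::] -> last x p != x.
Proof.
case/lastP: p => // p y; rewrite last_rcons => rp _; apply/eqP => yx.
by have := @acyclic (x :: p); rewrite /= -{2}yx rp => /(_ isT).
Qed.

Lemma acyclic_uniq x p : path r x p -> uniq (x :: p).
Proof.
elim: p x => // y p IH x rxp; rewrite cons_uniq; apply/andP; split; last first.
  by case/andP: rxp => _ /IH.
apply/negP; move: (y :: p) rxp => {IH p y} q rxq xq.
case/splitPr: xq rxq => p1 p2; rewrite cat_path => /and3P[rp1 rx _].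
by have := @acyclic (x :: p1); rewrite /= rcons_path rp1 rx => /(_ isT).
Qed.

(** In a shortest path every arc joins consecutive vertices: a forward chord would
    be a shortcut and a backward one would close a cycle. *)
Lemma shortest_path_arcs x p : path r x p ->
  (forall p', path r x p' -> last x p' = last x p -> size p <= size p') ->
  forall a b, a \in x :: p -> b \in x :: p -> r a b = ((a, b) \in zip (x :: p) p).
Proof.
move=> rp short a b Lap Lbp; apply/idP/idP; last exact: path_zip.
move: Lap rp short Lbp => /splitPl[p1 p2 p1a] rp short Lbp rab.
move: rp; rewrite cat_path p1a => /andP[rp1 rp2].
have [|Nbp1] := boolP (b \in x :: p1).
  move=> bp1; move: bp1 p1a rp1 {short Lbp} => /splitPl[p3 p4 p3b].
  rewrite last_cat p3b cat_path p3b => p4a /andP[_ rp4].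
  by have := @acyclic (b :: p4); rewrite /= rcons_path rp4 p4a rab => /(_ isT).
have bp2 : b \in p2.
  by move: Lbp Nbp1; rewrite -cat_cons mem_cat => /orP[->|].
case/splitPr: bp2 rp2 short {Lbp} => p5 p6.
rewrite cat_path /= => /and3P[_ _ rp6] /(_ (p1 ++ b :: p6)).
rewrite cat_path p1a rp1 /= rab rp6 !last_cat /= => /(_ isT erefl).
case: p5 => [_|z p5]; first by apply/mem_zip_path; exists p1, p6.
by rewrite !size_cat /= leq_add2l addSn leqNgt ltnS leq_addl.
Qed.

End Acyclic.

Section TransitiveMinimal.
Variables (T : finType) (r : rel T).

(** The minimum number of predecessors in W is zero: a predecessor of s in W would
    have strictly fewer of them. *)
Lemma transitive_minimal (W : {set T}) : W != set0 ->
  {in W, irreflexive r} -> {in W & &, transitive r} ->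
  exists2 s, s \in W & forall x, x \in W -> ~~ r x s.
Proof.
move=> /set0Pn[x0 Wx0] irr tr.
case: (arg_minnP (fun s => #|[set x in W | r x s]|) Wx0) => s Ws min_s.
exists s => // x Wx; apply/negP => rxs.
have := min_s x Wx; rewrite leqNgt => /negP[]; apply: proper_card.
apply/properP; split.
  apply/subsetP => y; rewrite !inE => /andP[Wy ryx]; rewrite Wy /=.
  exact: (tr _ _ _ _ _ _ ryx rxs).
by exists x; rewrite !inE Wx ?irr.
Qed.
End TransitiveMinimal.

Section AcyclicSource.
Variables (T : finType) (r : rel T).
Hypothesis acyclic : forall s, cycle r s -> s = [::].

Let tc x y := [exists z, r x z && connect r z y].

Let tc_irr x : tc x x = false.
Proof.
rewrite /tc; apply/negbTE/negP => /existsP[z /andP[rxz /connectP[p rp xp]]].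
by have := @acyclic (z :: p); rewrite /= rcons_path rp -xp rxz => /(_ isT).
Qed.

Let tc_trans : transitive tc.
Proof.
rewrite /tc => y x z; move/existsP=> [u /andP[rxu cuy]]; move/existsP=> [v /andP[ryv cvz]].
apply/existsP; exists u; rewrite rxu.
exact: (connect_trans cuy (connect_trans (connect1 ryv) cvz)).
Qed.

Let r_tc x y : r x y -> tc x y.
Proof. by move=> rxy; rewrite /tc; apply/existsP; exists y; rewrite rxy connect0. Qed.

Lemma acyclic_source (W : {set T}) : W != set0 ->
  exists2 s, s \in W & forall x, x \in W -> ~~ r x s.
Proof.
move=> W0; have [x _|y x z _ _ _|s Ws src] := @transitive_minimal _ tc W W0.
- exact: tc_irr.
- exact: tc_trans.
by exists s => // x Wx; apply: contra (src x Wx); apply: r_tc.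
Qed.

Lemma acyclic_sink (W : {set T}) : W != set0 ->
  exists2 t, t \in W & forall x, x \in W -> ~~ r t x.
Proof.
move=> W0; have [x _|y x z _ _ _ yx zy|t Wt snk] :=
  @transitive_minimal _ (fun x y => tc y x) W W0.
- exact: tc_irr.
- exact: (tc_trans zy yx).
by exists t => // x Wx; apply: contra (snk x Wx); apply: r_tc.
Qed.
End AcyclicSource.

(** * Digons and single arcs *)

Section Arcs.
Variable D : digraph.
Implicit Types x y z : D.

Definition digon_nbh x : {set D} := [set y | digon x y].

Lemma digon_nbhE x y : (y \in digon_nbh x) = digon x y.
Proof. by rewrite inE. Qed.

Lemma digonC x y : digon x y = digon y x.
Proof. by rewrite /digon andbC. Qed.

Lemma adjacentC x y : adjacent x y = adjacent y x.
Proof. by rewrite /adjacent orbC. Qed.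

Lemma single_arcC x y : single_arc x y = single_arc y x.
Proof. by rewrite /single_arc addbC. Qed.

Lemma arcxx x : arc x x = false.
Proof. exact: arc_irr. Qed.

Lemma adjacentE x y : adjacent x y = digon x y || single_arc x y.
Proof. by rewrite /adjacent /digon /single_arc; do 2!case: arc. Qed.

Lemma single_arcE x y : single_arc x y = to x y || to y x.
Proof. by rewrite /single_arc /to; do 2!case: arc. Qed.

Lemma single_arcN x y : single_arc x y = adjacent x y && ~~ digon x y.
Proof. by rewrite /adjacent /digon /single_arc; do 2!case: arc. Qed.

Lemma arcE x y : arc x y = digon x y || to x y.
Proof. by rewrite /digon /to; do 2!case: arc. Qed.

Lemma to_arc x y : to x y -> arc x y.
Proof. by case/andP. Qed.

Lemma digon_arc x y : digon x y -> arc x y.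
Proof. by case/andP. Qed.

Lemma digon_neq x y : digon x y -> x != y.
Proof. by apply: contraTneq => ->; rewrite digon_irr. Qed.

Lemma to_single x y : to x y -> single_arc x y.
Proof. by rewrite single_arcE => ->. Qed.

Lemma to_irr x : to x x = false.
Proof. by rewrite /to arcxx. Qed.

Lemma to_neq x y : to x y -> x != y.
Proof. by apply: contraTneq => ->; rewrite /to arcxx. Qed.

Lemma single_neq x y : single_arc x y -> x != y.
Proof. by apply: contraTneq => ->; rewrite /single_arc addbb. Qed.

Lemma adjacent_neq x y : adjacent x y -> x != y.
Proof. by apply: contraTneq => ->; rewrite /adjacent arcxx. Qed.

Lemma to_Ndigon x y : to x y -> digon x y = false.
Proof. by rewrite /digon /to; do 2!case: arc. Qed.

Lemma to_asym x y : to x y -> to y x = false.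
Proof. by rewrite /to; do 2!case: arc. Qed.

Lemma single_Ndigon x y : single_arc x y -> digon x y = false.
Proof. by rewrite single_arcN => /andP[_ /negPf]. Qed.

Lemma single_adjacent x y : single_arc x y -> adjacent x y.
Proof. by rewrite single_arcN => /andP[]. Qed.

Lemma digon_adjacent x y : digon x y -> adjacent x y.
Proof. by rewrite adjacentE => ->. Qed.

End Arcs.

(** * The obstructions, in terms of vertices *)

Definition F2_arcs (T : Type) (v1 v2 u1 : T) (us : seq T) (w1 w2 : T) : seq (T * T) :=
  [:: (v1, v2); (v2, v1); (v1, u1); (v2, u1)]
    ++ zip (u1 :: us) us
    ++ [:: (last u1 us, w1); (last u1 us, w2); (w1, w2); (w2, w1)].

(** The right-hand side of the theorem, spelled out on the vertices of one digraph;
    unlike a statement about induced copies, it restricts to subdigraphs at once.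
    In F1 the listed vertices are pairwise adjacent, hence distinct, whereas for the
    cycle and for F2 distinctness is stated by [uniq]. *)
Record tame (D : digraph) : Prop := Tame {
  tame_in : forall v u w : D, arc u v -> arc w v -> u != w -> adjacent u w;
  tame_out : forall v u w : D, arc v u -> arc v w -> u != w -> adjacent u w;
  tame_F1a : forall a b c d : D, digon a c -> digon b d ->
    single_arc a b -> single_arc c d -> adjacent b c -> adjacent d a -> False;
  tame_F1b : forall a b c d : D, digon a d -> digon a c ->
    to b c -> to d c -> to d b -> single_arc a b -> False;
  tame_F1c : forall a b c d : D, digon c d ->
    to b c -> to d a -> to a c -> to d b -> single_arc a b -> False;
  tame_F1d : forall a b c : D, to a b -> to b c -> to c a -> False;
  tame_simplicial : forall B : {set D}, B != set0 ->
    exists2 v, v \in B & forall u w, u \in B -> w \in B ->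
      digon v u -> digon v w -> u != w -> digon u w;
  tame_cycle : forall s : seq D, 1 < size s -> uniq s ->
    (forall x y, x \in s -> y \in s -> arc x y = (next s x == y)) ->
    (forall x y, x \in s -> y \in s -> ~~ digon x y) -> False;
  tame_F2 : forall (v1 v2 u1 : D) (us : seq D) (w1 w2 : D),
    let s := [:: v1; v2] ++ (u1 :: us) ++ [:: w1; w2] in
    uniq s ->
    (forall x y, x \in s -> y \in s ->
      arc x y = ((x, y) \in F2_arcs v1 v2 u1 us w1 w2)) -> False
}.

(** * Comparable neighbourhoods and simplicial vertices *)

Section Simplicial.
Variables (D : digraph) (tD : tame D).
Implicit Types x y z a b c u v w : D.

Let F1d := tame_F1d tD.

Lemma transitive_to a b c : to a b -> to b c -> adjacent a c ->
  ~~ digon a c -> to a c.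
Proof.
move=> ab bc; rewrite adjacentE single_arcE => /or3P[-> //|//|ca].
by case: (F1d ab bc ca).
Qed.

(** The ends y and b are both in-neighbours or both out-neighbours of a, because a
    digon can play either part. *)
Lemma digon_single_adjacent y a b : digon y a -> single_arc a b -> adjacent y b.
Proof.
move=> ya ab; have yb : y != b.
  by apply: contraTneq ab => <-; rewrite single_arcN digonC ya andbF.
case/andP: ya => ya ay; move: ab; rewrite single_arcE.
by case/orP=> /to_arc h; [exact: (tame_out tD ay h) | exact: (tame_in tD ya h)].
Qed.

Lemma digon2_adjacent z a b : digon z a -> digon z b -> a != b -> adjacent a b.
Proof. by move=> /digon_arc za /digon_arc zb; apply: (tame_out tD za zb). Qed.

(** With y in N(a) but not in N(b), and y' in N(b) but not in N(a), the digons a y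
    and b y' and the single arcs a y' and b y make up the family (a). *)
Lemma digon_nbh_comparable a b : single_arc a b ->
  (digon_nbh a \subset digon_nbh b) || (digon_nbh b \subset digon_nbh a).
Proof.
move=> ab; case: (boolP (_ \subset _)) => //= /subsetPn[y].
rewrite !digon_nbhE => ay yb; apply/subsetPn => -[y']; rewrite !digon_nbhE => by' y'a.
have ba : single_arc b a by rewrite single_arcC.
have ya : digon y a by rewrite digonC.
have y'b : digon y' b by rewrite digonC.
have ybs : single_arc y b.
  by rewrite single_arcN (digon_single_adjacent ya ab) digonC yb.
have y'as : single_arc y' a.
  by rewrite single_arcN (digon_single_adjacent y'b ba) digonC y'a.
have y'y : adjacent y' y.
  by apply: (digon_single_adjacent y'b); rewrite single_arcC.
by apply: (tame_F1a tD ay y'b _ ybs y'y); rewrite 1?single_arcC // adjacentC single_adjacent.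
Qed.

Lemma digon2_single z a b : digon z a -> digon z b -> a != b ->
  ~~ digon a b -> single_arc a b.
Proof. by move=> za zb ab; rewrite single_arcN (digon2_adjacent za zb). Qed.

(** The pair (u, w) witnesses that v is not semi-strict di-simplicial. *)
Definition violation u v w := [&& arc u v, arc v w, u != w & ~~ digon u w].

Lemma not_good_violation v : ~ semi_strict_di_simplicial v -> exists u w, violation u v w.
Proof.
move=> ng; apply: NNPP => nb; apply: ng => u w; rewrite !inE => uv vw uw.
by apply/andP/negPn/negP => nuw; apply: nb; exists u, w; apply/and4P.
Qed.

(** Let v be simplicial in S(D) with X = N(v) minimal, and let W be the class of the
    vertices b with N(b) = X.  If b in W is joined by a single arc to y, then X is
    contained in N(y), because otherwise N(y) would be smaller and y would be
    simplicial too.  So a violation at b consists of single arcs u -> b -> w, u -> w,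
    and as (b) is excluded, u or w is in W.  At the source s of W the one in W must be
    the out-neighbour, at the sink t the in-neighbour.  The other one at s, u, and the
    other one at t, w', satisfy u -> {s, t} -> w'.  They are joined by a digon,
    since otherwise they would be a violation at s, and (c) appears. *)
Lemma closed_set_good (B : {set D}) : B != set0 ->
  (forall v, v \in B -> digon_nbh v != set0) ->
  (forall v w, v \in B -> adjacent v w -> w \in B) ->
  exists v : D, semi_strict_di_simplicial v.
Proof.
move=> B0 nzB clB.
pose simp v := [forall u, forall w, [&& digon v u, digon v w & u != w] ==> digon u w].
have simpP v : reflect (forall u w, digon v u -> digon v w -> u != w -> digon u w) (simp v).
  apply: (iffP forallP) => [h u w vu vw uw|h u].
    by have /forallP/(_ w)/implyP := h u; apply; apply/and3P.
  by apply/forallP => w; apply/implyP => /and3P[]; apply: h.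
have [v0 Bv0 /= sv0] : exists2 v, v \in B & simp v.
  have [v Bv sv] := tame_simplicial tD B0; exists v => //.
  by apply/simpP => u w vu vw; apply: sv => //; apply: (clB _ _ Bv (digon_adjacent _)).
pose simpB := [pred v | (v \in B) && simp v].
have P0 : simpB v0 by rewrite /= Bv0.
case: (arg_minnP (fun v => #|digon_nbh v|) P0) => v /andP[Bv sv] min_v {v0 Bv0 sv0 P0}.
set X := digon_nbh v in min_v *.
pose W := [set b | digon_nbh b == X].
have WE b : b \in W -> digon_nbh b = X by rewrite inE => /eqP.
have vW : v \in W by rewrite inE.
(* A fixed z in X makes any two vertices b with X inside N(b) adjacent. *)
have [z zX] := set0Pn _ (nzB v Bv).
have vz : digon v z by rewrite digon_nbhE in zX.
have Bz : z \in B := clB _ _ Bv (digon_adjacent vz).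
have zW b : b \in W -> digon z b by move=> /WE bX; rewrite digonC -digon_nbhE bX.
have WB b : b \in W -> b \in B.
  by move=> /zW/digon_adjacent; apply: clB.
have Wsimp b : b \in W -> simp b.
  move=> /WE bX; apply/simpP=> u w; rewrite -!digon_nbhE bX !digon_nbhE.
  exact: (simpP _ sv).
have Xsub b y : b \in W -> single_arc b y -> X \subset digon_nbh y.
  move=> Wb sby; have [//|ny] := boolP (X \subset digon_nbh y).
  have := digon_nbh_comparable sby; rewrite (WE b Wb) (negPf ny) /= => sub.
  have By : y \in B := clB _ _ (WB b Wb) (single_adjacent sby).
  have := min_v y; rewrite /= By /= leqNgt proper_card /proper ?sub //.
  apply; apply/simpP=> p q; rewrite -!digon_nbhE => /(subsetP sub) + /(subsetP sub).
  by rewrite /X !digon_nbhE; apply: (simpP _ sv).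
have WN x y : x \in W -> y \in W -> ~~ digon x y.
  by move=> Wx Wy; rewrite -digon_nbhE (WE x) // -(WE y) // digon_nbhE digon_irr.
have Wadj x y : x \in W -> y \in W -> x != y -> single_arc x y.
  by move=> Wx Wy xy; apply: (@digon2_single z); rewrite ?zW ?WN.
have key u b w : b \in W -> violation u b w ->
    [/\ to u b, to b w, to u w & (u \in W) || (w \in W)].
  move=> Wb /and4P[ub bw uw nuw].
  have NE x y : digon b x -> X \subset digon_nbh y -> digon x y.
    move=> bx sub.
    by rewrite digonC -digon_nbhE (subsetP sub) // -(WE b Wb) digon_nbhE.
  have tub : to u b.
    move: (ub); rewrite arcE => /orP[dub|//]; case/negP: nuw.
    have dbu : digon b u by rewrite digonC.
    move: bw; rewrite arcE => /orP[dbw|tbw].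
      exact: (simpP _ (Wsimp b Wb)).
    by apply: NE dbu _; apply: Xsub (to_single tbw).
  have tbw : to b w.
    move: (bw); rewrite arcE => /orP[dbw|//]; case/negP: nuw.
    rewrite digonC; apply: NE dbw _; apply: (Xsub b) => //.
    by rewrite single_arcC to_single.
  have subu : X \subset digon_nbh u by apply: (Xsub b); rewrite // single_arcC to_single.
  have subw : X \subset digon_nbh w by apply: (Xsub b); rewrite // to_single.
  have zu : digon z u by rewrite digonC -digon_nbhE (subsetP subu).
  have zw : digon z w by rewrite digonC -digon_nbhE (subsetP subw).
  have tuw : to u w := transitive_to tub tbw (digon2_adjacent zu zw uw) nuw.
  split=> //.
  (* Otherwise y, b, w, u induce the family (b), with digons y u and y w. *)
  have common y : y \in digon_nbh u -> y \in digon_nbh w -> y \in X.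
    rewrite !digon_nbhE => uy wy; apply/negPn/negP => nyX.
    apply: (@tame_F1b D tD y b w u); rewrite // 1?digonC //.
    rewrite single_arcN -(@digonC _ b) -digon_nbhE (WE b Wb) digon_nbhE nyX andbT.
    by apply: (@digon_single_adjacent _ u); rewrite 1?digonC ?to_single.
  rewrite !inE !eqEsubset subu subw !andbT.
  case/orP: (digon_nbh_comparable (to_single tuw)) => sub; apply/orP; [left|right];
    by apply/subsetP => y yN; apply: common => //; apply: (subsetP sub).
have trW : {in W & &, transitive (@to D)}.
  move=> b a c Wb Wa Wc ab bc; have ac : a != c.
    by apply: contraTneq bc => <-; rewrite (to_asym ab).
  by apply: (transitive_to ab bc _ (WN _ _ Wa Wc)); apply/single_adjacent/Wadj.
have W0 : W != set0 by apply/set0Pn; exists v.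
have [x _||s Ws src] := @transitive_minimal _ (@to D) W W0; [exact: to_irr|exact: trW|].
have [x _|b a c Wb Wa Wc ba cb|t Wt snk] :=
  @transitive_minimal _ (fun x y => to y x) W W0; [exact: to_irr|exact: trW cb ba|].
have [good_s|] := classic (semi_strict_di_simplicial s); first by exists s.
move=> /not_good_violation[u [w bad_s]].
have [us sw uw] := key _ _ _ Ws bad_s.
have Wu : u \notin W by apply: contraL us => /src.
rewrite (negPf Wu) /= => Ww.
have [good_t|] := classic (semi_strict_di_simplicial t); first by exists t.
move=> /not_good_violation[u' [w' bad_t]].
have [u't tw' u'w'] := key _ _ _ Wt bad_t.
have Ww' : w' \notin W by apply: contraL tw' => /snk.
rewrite (negPf Ww') orbF => Wu'.
have st_neq : s != t by apply: contraTneq sw => ->; apply: snk.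
have st : to s t.
  by have := Wadj _ _ Ws Wt st_neq; rewrite single_arcE (negPf (src _ Wt)) orbF.
have zu : digon z u.
  by rewrite digonC -digon_nbhE (subsetP (Xsub s u Ws _)) // single_arcC to_single.
have zw' : digon z w'.
  by rewrite digonC -digon_nbhE (subsetP (Xsub t w' Wt _)) // to_single.
have NW x y : x \in W -> y \in W -> digon x =1 digon y.
  by move=> Wx Wy p; rewrite -!digon_nbhE (WE x) // (WE y).
have ut : to u t.
  apply: (transitive_to us st).
    by apply: (digon2_adjacent zu (zW t Wt)); apply: contraNneq Wu => ->.
  by rewrite digonC (NW t s) // digonC to_Ndigon.
have sw' : to s w'.
  apply: (transitive_to st tw').
    by apply: (digon2_adjacent (zW s Ws) zw'); apply: contraNneq Ww' => <-.
  by rewrite (NW s t) // to_Ndigon.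
have uw'_neq : u != w' by apply: contraTneq ut => ->; rewrite (to_asym tw').
have [duw'|nuw'] := boolP (digon u w').
  by case: (@tame_F1c D tD s t w' u); rewrite // 1?digonC // to_single.
have /(key _ _ _ Ws)[_ _ _] : violation u s w'.
  by rewrite /violation (to_arc us) (to_arc sw') uw'_neq.
by rewrite (negPf Wu) (negPf Ww').
Qed.
End Simplicial.

(** * Vertices on no digon *)

Notation same := (connect (@digon _)).

Section Isolated.
Variables (D : digraph) (tD : tame D).
Implicit Types x y z a b c u v w : D.

Let F1d := tame_F1d tD.

Lemma digon_connect_sym : connect_sym (@digon D).
Proof. by apply: sym_connect_sym => x y; rewrite digonC. Qed.

(** Isolated in S(D), not in D. *)
Definition isolated x := digon_nbh x == set0.

Lemma isolatedN x y : isolated x -> digon x y = false.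
Proof. by move=> /eqP x0; rewrite -digon_nbhE x0 inE. Qed.

Lemma isolatedPn x : reflect (exists y, digon x y) (~~ isolated x).
Proof. by apply: (iffP (set0Pn _)) => -[y]; exists y; rewrite ?digon_nbhE // -digon_nbhE. Qed.

Lemma isolated_connect x y : isolated x -> same x y -> x = y.
Proof. by move=> ix /connectP[[|z p] /=]; rewrite ?isolatedN. Qed.

Lemma nonisolated_connect x y : same x y -> isolated x = isolated y.
Proof.
move=> xy; apply/idP/idP => i; first by rewrite -(isolated_connect i xy).
by rewrite digon_connect_sym in xy; rewrite -(isolated_connect i xy).
Qed.

Lemma isolated_adjacent x y : isolated x -> adjacent x y -> single_arc x y.
Proof. by move=> ix; rewrite single_arcN isolatedN // andbT. Qed.

Lemma isolated_to x y : isolated x -> arc x y = to x y.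
Proof. by move=> ix; rewrite arcE isolatedN. Qed.

Lemma isolated_from x y : isolated x -> arc y x = to y x.
Proof. by move=> ix; rewrite arcE digonC isolatedN. Qed.

(** Nonempty digon neighbourhoods that are comparable have a common vertex. *)
Lemma nonisolated_adjacent_connect x y :
  ~~ isolated x -> ~~ isolated y -> adjacent x y -> same x y.
Proof.
move=> nx ny; rewrite adjacentE => /orP[/connect1//|/(digon_nbh_comparable tD)].
case/orP=> /subsetP sub.
  have [z xz] := isolatedPn _ nx; have := sub z; rewrite !digon_nbhE xz => /(_ isT) yz.
  by apply: connect_trans (connect1 xz) (connect1 _); rewrite digonC.
have [z yz] := isolatedPn _ ny; have := sub z; rewrite !digon_nbhE yz => /(_ isT) xz.
by apply: connect_trans (connect1 xz) (connect1 _); rewrite digonC.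
Qed.

(** Adjacency to x spreads along digons: all arcs at x are single, so that
    [digon_single_adjacent] applies at each step. *)
Lemma isolated_adjacent_connect x a b :
  isolated x -> adjacent x a -> same a b -> adjacent x b.
Proof.
move=> ix + /connectP[p + ->]; elim: p a => //= c p IH a xa /andP[ac].
apply: IH; rewrite adjacentC; apply: (@digon_single_adjacent _ tD _ a).
  by rewrite digonC.
by rewrite single_arcC isolated_adjacent.
Qed.

(** If single arcs a -> x -> b pass through an isolated x, and a single arc joins a
    and b inside their component, then a common digon neighbour of a and b completes
    either a directed triangle or the family (b).  So it is enough that a and b be
    adjacent, and this follows along a digon path from a to b: every out-neighbour
    of x on it is joined to a by a digon, while every in-neighbour of x is adjacent
    to a anyway. *)
Lemma through_isolated x a b :
  isolated x -> to a x -> to x b -> same a b -> digon a b.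
Proof.
move=> ix ax xb ab.
have adj_x c : same a c -> adjacent x c.
  by apply: (isolated_adjacent_connect ix); rewrite adjacentC single_adjacent ?to_single.
have na : ~~ isolated a.
  apply: contraL ab => ia; apply/negP => /(isolated_connect ia) ab.
  by move: xb; rewrite -ab to_asym.
have adj_digon c : same a c -> to x c -> adjacent a c -> digon a c.
  move=> ac xc; rewrite adjacentE => /orP[//|sac].
  have nc : ~~ isolated c by rewrite -(nonisolated_connect ac).
  have [z az cz] : exists2 z, digon z a & digon z c.
    case/orP: (digon_nbh_comparable tD sac) => /subsetP sub.
      have [z az] := isolatedPn _ na; have := sub z; rewrite !digon_nbhE az => /(_ isT) cz.
      by exists z; rewrite digonC.
    have [z cz] := isolatedPn _ nc; have := sub z; rewrite !digon_nbhE cz => /(_ isT) az.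
    by exists z; rewrite digonC.
  have sz : same a z by apply: connect1; rewrite digonC.
  move: sac; rewrite single_arcE => /orP[tac|tca]; last by case: (F1d ax xc tca).
  case: (@tame_F1b D tD z x c a) => //.
  by rewrite single_arcC isolated_adjacent ?adj_x.
pose ok c := to x c -> digon a c.
have walk p c : path (@digon D) c p -> same a c -> ok c -> ok (last c p).
  elim: p c => //= d p IH c /andP[cd dp] ac okc.
  have ad : same a d := connect_trans ac (connect1 cd).
  apply: (IH d dp ad) => xd; apply: adj_digon => //.
  have [adE|a_neq_d] := eqVneq a d; first by rewrite -adE (to_asym ax) in xd.
  have [->|a_neq_c] := eqVneq a c; first exact: digon_adjacent.
  have := adj_x c ac; move/(isolated_adjacent ix); rewrite single_arcE => /orP[xc|cx].
    by apply: (digon2_adjacent tD _ cd) => //; rewrite digonC okc.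
  have := tame_in tD (to_arc ax) (to_arc cx) a_neq_c.
  rewrite adjacentE => /orP[dac|sac].
    by apply: (digon2_adjacent tD _ cd) => //; rewrite digonC.
  rewrite adjacentC; apply: (@digon_single_adjacent _ tD _ c); first by rewrite digonC.
  by rewrite single_arcC.
have /connectP[p ap bE] := ab; rewrite bE in xb *.
by apply: (walk p a ap) => // xa; rewrite (to_asym ax) in xa.
Qed.

Definition mixed x := isolated x &&
  [exists a, exists b, [&& digon a b, to a x & to x b]].

Lemma mixedP x : reflect (isolated x /\ exists a b, [/\ digon a b, to a x & to x b])
  (mixed x).
Proof.
apply: (iffP andP) => -[ix h]; split=> //.
  by case/existsP: h => a /existsP[b /and3P[ab ax xb]]; exists a, b.
by case: h => a [b [ab ax xb]]; apply/existsP; exists a; apply/existsP; exists b; apply/and3P.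
Qed.

Lemma mixed_isolated x : mixed x -> isolated x.
Proof. by case/andP. Qed.

Lemma unmixed_to x a b : isolated x -> ~~ mixed x -> same a b -> to x a -> to x b.
Proof.
move=> ix mx /connectP[p + ->]; elim: p a => //= c p IH a /andP[ac cp] xa.
apply: IH cp _; have := isolated_adjacent_connect ix _ (connect1 ac).
rewrite single_adjacent ?to_single // => /(_ isT)/(isolated_adjacent ix).
rewrite single_arcE => /orP[//|cx]; case/mixedP: mx; split=> //.
by exists c, a; rewrite digonC.
Qed.

Lemma unmixed_from x a b : isolated x -> ~~ mixed x -> same a b -> to a x -> to b x.
Proof.
move=> ix mx ab ax.
have : adjacent x b.
  by apply: isolated_adjacent_connect ix _ ab; rewrite adjacentC single_adjacent ?to_single.
move/(isolated_adjacent ix); rewrite single_arcE => /orP[|//].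
rewrite digon_connect_sym in ab => /(unmixed_to ix mx ab).
by rewrite (to_asym ax).
Qed.

(** A mixed vertex sees a single nontrivial component, since its in-neighbours are
    pairwise adjacent, and so are its out-neighbours. *)
Lemma mixed_connect x y a b : isolated x -> digon a b -> to a x -> to x b ->
  adjacent x y -> ~~ isolated y -> same a y.
Proof.
move=> ix ab ax xb xy ny.
have na : ~~ isolated a by apply/isolatedPn; exists b.
have nb : ~~ isolated b by apply/isolatedPn; exists a; rewrite digonC.
case/orP: xy => [xy|yx].
  apply: connect_trans (connect1 ab) _; have [->//|b_neq_y] := eqVneq b y.
  apply: nonisolated_adjacent_connect => //.
  exact: (tame_out tD (to_arc xb) xy b_neq_y).
have [->//|a_neq_y] := eqVneq a y.
apply: nonisolated_adjacent_connect => //.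
exact: (tame_in tD (to_arc ax) yx a_neq_y).
Qed.

(** Suppose that x and y are adjacent.  A digon c d with c -> x -> d cannot be
    separated by y as well: in the same direction this is the family (c), in the
    opposite one it closes a directed triangle.  As [through_isolated] joins every
    in-neighbour of x in the component to every out-neighbour by a digon, the whole
    component lies on one side of y. *)
Lemma mixed_nonadjacent x y a b p q : isolated x -> isolated y ->
  digon a b -> to a x -> to x b -> digon p q -> to p y -> to y q ->
  same a p -> ~~ adjacent x y.
Proof.
move=> ix iy ab ax xb pq py yq ap; apply/negP => xy.
have sxy := isolated_adjacent ix xy.
have ya : adjacent y a.
  rewrite digon_connect_sym in ap; apply: isolated_adjacent_connect iy _ ap.
  by rewrite adjacentC single_adjacent ?to_single.
have same_side c d : same a c -> digon c d -> to c x -> to x d -> to c y = to d y.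
  move=> ac cd cx xd.
  have yc : to y c || to c y.
    by rewrite -single_arcE isolated_adjacent ?(isolated_adjacent_connect iy ya).
  have yd : to y d || to d y.
    rewrite -single_arcE isolated_adjacent ?(isolated_adjacent_connect iy ya) //.
    exact: connect_trans ac (connect1 cd).
  case/orP: yc => [yc|cy]; case/orP: yd => [yd|dy].
  - by rewrite (to_asym yc) (to_asym yd).
  - move: sxy; rewrite single_arcE => /orP[txy|tyx].
      by case: (F1d yc cx txy).
    by case: (F1d xd dy tyx).
  - by case: (@tame_F1c D tD x y d c); rewrite // digonC.
  - by rewrite cy dy.
have all_same c : same a c -> to c y = to a y.
  move=> ac.
  have : adjacent x c.
    by apply: (isolated_adjacent_connect ix _ ac); rewrite adjacentC single_adjacent ?to_single.
  move/(isolated_adjacent ix); rewrite single_arcE => /orP[xc|cx].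
    have dac := through_isolated ix ax xc ac.
    by rewrite (same_side a c).
  have cb : same c b.
    by rewrite digon_connect_sym in ac; apply: connect_trans ac (connect1 ab).
  by rewrite (same_side c b) ?(same_side a b) // (through_isolated ix cx xb cb).
have aq := connect_trans ap (connect1 pq).
have := all_same q aq; rewrite -(all_same p ap) py.
by rewrite (to_asym yq).
Qed.

End Isolated.

(** * The skeleton *)

Section Skeleton.
Variables (D : digraph) (tD : tame D).
Implicit Types x y z a b c u v w : D.

Let F1d := tame_F1d tD.

(** The roots pick one vertex of each component of S(D). *)
Definition skeleton : {set D} :=
  [set x | (root (@digon D) x == x) && ~~ mixed x].

Definition skeleton_arc x y := [&& x \in skeleton, y \in skeleton & to x y].

Lemma skeletonP x :
  reflect (root (@digon D) x = x /\ ~~ mixed x) (x \in skeleton).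
Proof. by rewrite inE; apply: (iffP andP) => -[/eqP]. Qed.

Lemma skeleton_same x y : x \in skeleton -> y \in skeleton -> same x y -> x = y.
Proof.
move=> /skeletonP[xE _] /skeletonP[yE _].
by rewrite -(root_connect (@digon_connect_sym D)) xE yE => /eqP.
Qed.

Lemma skeleton_root x : ~~ isolated x -> root (@digon D) x \in skeleton.
Proof.
move=> nx; apply/skeletonP; split; first exact: (root_root (@digon_connect_sym D)).
apply: contra nx => /mixed_isolated.
by rewrite -(nonisolated_connect (connect_root _ x)).
Qed.

Lemma skeleton_isolated x : isolated x -> ~~ mixed x -> x \in skeleton.
Proof.
move=> ix mx; apply/skeletonP; split=> //.
by rewrite -(isolated_connect ix (connect_root _ x)).
Qed.

Lemma skeleton_nonempty : skeleton != set0.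
Proof.
apply/set0Pn; have /card_gt0P[x _] := vertex_gt0 D.
have [ix|nx] := boolP (isolated x); last by exists (root (@digon D) x); apply: skeleton_root.
have [/mixedP[_ [a [b [ab _ _]]]]|mx] := boolP (mixed x); last first.
  by exists x; apply: skeleton_isolated.
exists (root (@digon D) a); apply: skeleton_root.
by apply/isolatedPn; exists b.
Qed.

(** In a shortest closed walk no vertex repeats and no chord occurs, and the skeleton
    contains no digon: it would be a forbidden induced cycle. *)
Lemma skeleton_acyclic s : cycle skeleton_arc s -> s = [::].
Proof.
have [n] := ubnP (size s); elim: n s => // n IH s; rewrite ltnS => sn rs.
apply/eqP; rewrite -size_eq0 -leqn0 leqNgt; apply/negP => s_gt0.
have shorter s' : cycle skeleton_arc s' -> s' != [::] -> size s' < size s -> False.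
  by move=> rs' s'0 lt; case/eqP: s'0; apply: IH rs'; apply: leq_trans lt sn.
have us : uniq s.
  (* Starting from a repeated vertex x, cut the walk at the next visit to x. *)
  have [x0 _] : exists x, x \in s.
    by case: (s) s_gt0 => // x s' _; exists x; rewrite mem_head.
  apply/negPn/negP => /(uniqPn x0)[i [j [ij js]]].
  set x := nth x0 s i => xE.
  have is_ : i < size s := ltn_trans ij js.
  have rotE : rot i s = x :: (drop i.+1 s ++ take i s).
    by rewrite /rot (drop_nth x0).
  have : cycle skeleton_arc (rot i s) by rewrite rot_cycle.
  have xin : x \in drop i.+1 s ++ take i s.
    rewrite mem_cat xE -[j](subnKC ij) -nth_drop mem_nth //.
    by rewrite size_drop ltn_sub2r // (leq_ltn_trans ij).
  have := size_rot i s; rewrite rotE => sE rx.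
  case/splitPr: xin sE rx => p1 p2 /= sE.
  rewrite rcons_cat cat_path /= => /and3P[rp1 rx _].
  apply: (shorter (x :: p1)); rewrite //= ?rcons_path ?rp1 //.
  by rewrite -sE size_cat /= ltnS -addSnnS leq_addr.
have sP x : x \in s -> x \in skeleton by move=> /(next_cycle rs)/and3P[].
have nd x y : x \in s -> y \in s -> ~~ digon x y.
  move=> /sP Px /sP Py; apply/negP => xy.
  by move: (digon_neq xy); rewrite (skeleton_same Px Py (connect1 xy)) eqxx.
apply: (tame_cycle tD _ us _ nd) => [|x y sx sy].
  case: s s_gt0 rs {sn shorter us sP nd IH} => [|x [|]] //= _.
  by rewrite /skeleton_arc to_irr !andbF.
have arcE' : arc x y = skeleton_arc x y.
  by rewrite /skeleton_arc !sP // arcE (negPf (nd x y sx sy)).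
rewrite arcE'; apply/idP/eqP => [rxy|<-]; last exact: next_cycle.
(* A chord from x to y bypasses the vertices between them. *)
have [i p pE] := rot_to sx.
have up : uniq (x :: p) by rewrite -pE rot_uniq.
have : cycle skeleton_arc (x :: p) by rewrite -pE rot_cycle.
have : y \in x :: p by rewrite -pE mem_rot.
have sE : size s = (size p).+1 by rewrite -(size_rot i) pE.
rewrite -(next_rot i us) pE in_cons => /orP[/eqP yx|yp].
  by move: rxy; rewrite yx /skeleton_arc to_irr !andbF.
case/splitPr: yp {pE up} sE => [[|z p1] p2] sE; first by rewrite /= eqxx.
rewrite /= rcons_cat cat_path => /and3P[_ _ /= /andP[_ rp2]].
case: (shorter [:: x, y & p2]); rewrite //= ?rxy //.
by rewrite sE /= size_cat /= !ltnS addnS ltnS leq_addl.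
Qed.

(** If y is on a digon, the representative of its component will do, because s is
    not mixed.  If y is mixed, with a -> y -> b along a digon, then s, being an
    out-neighbour of y, is adjacent to b; and s -> b would give s -> a and the directed
    triangle y s a.  So b -> s, and the first case applies to b. *)
Lemma skeleton_in s y : s \in skeleton -> isolated s -> to y s ->
  exists y', skeleton_arc y' s.
Proof.
move=> Ps is_ ys; have [_ ms] := skeletonP _ Ps.
have via_root z : ~~ isolated z -> to z s -> exists y', skeleton_arc y' s.
  move=> nz zs; exists (root (@digon D) z); rewrite /skeleton_arc Ps skeleton_root //=.
  exact: (unmixed_from tD is_ ms (connect_root _ z) zs).
have [iy|ny] := boolP (isolated y); last exact: (via_root y).
have [/mixedP[_ [a [b [ab ay yb]]]]|my] := boolP (mixed y); last first.
  by exists y; rewrite /skeleton_arc Ps skeleton_isolated.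
have nb : ~~ isolated b by apply/isolatedPn; exists a; rewrite digonC.
apply: (via_root b nb).
have sb : s != b by apply: contraNneq nb => <-.
have /(isolated_adjacent is_) := tame_out tD (to_arc ys) (to_arc yb) sb.
rewrite single_arcE => /orP[tsb|//].
have sa : to s a by apply: (unmixed_to tD is_ ms _ tsb); apply: connect1; rewrite digonC.
by case: (F1d ys sa ay).
Qed.

Lemma skeleton_out s y : s \in skeleton -> isolated s -> to s y ->
  exists y', skeleton_arc s y'.
Proof.
move=> Ps is_ sy; have [_ ms] := skeletonP _ Ps.
have via_root z : ~~ isolated z -> to s z -> exists y', skeleton_arc s y'.
  move=> nz sz; exists (root (@digon D) z); rewrite /skeleton_arc Ps skeleton_root //=.
  exact: (unmixed_to tD is_ ms (connect_root _ z) sz).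
have [iy|ny] := boolP (isolated y); last exact: (via_root y).
have [/mixedP[_ [a [b [ab ay yb]]]]|my] := boolP (mixed y); last first.
  by exists y; rewrite /skeleton_arc Ps skeleton_isolated.
have na : ~~ isolated a by apply/isolatedPn; exists b.
apply: (via_root a na).
have sa : s != a by apply: contraNneq na => <-.
have /(isolated_adjacent is_) := tame_in tD (to_arc sy) (to_arc ay) sa.
rewrite single_arcE => /orP[//|tas].
have bs : to b s by apply: (unmixed_from tD is_ ms _ tas); apply: connect1.
by case: (F1d sy yb bs).
Qed.

(** If the component C of c is not closed under adjacency, some isolated w is attached
    to it, and w is mixed because c has no neighbour in the skeleton.  All
    neighbours of w are in C: another one would also be attached to C, hence mixed,
    against [mixed_nonadjacent].  So w is good by [through_isolated]. *)
Lemma isolated_rep_good c : c \in skeleton -> ~~ isolated c ->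
  (forall y, y \in skeleton -> ~~ adjacent c y) ->
  exists v : D, semi_strict_di_simplicial v.
Proof.
move=> Pc nc far; have csym := @digon_connect_sym D.
have unmixed_far y : isolated y -> ~~ mixed y -> ~~ adjacent c y.
  by move=> iy my; apply/far/skeleton_isolated.
pose B := [set w | same c w].
have [clB|] := classic (forall v w, v \in B -> adjacent v w -> w \in B).
  apply: (closed_set_good tD _ _ clB); first by apply/set0Pn; exists c; rewrite inE.
  by move=> v; rewrite inE => /nonisolated_connect; rewrite (negPf nc) /isolated => <-.
move=> ncl; have [v [w [Bv vw nBw]]] : exists v w, [/\ same c v, adjacent v w & ~~ same c w].
  apply: NNPP => h; apply: ncl => v w; rewrite !inE => cv vw.
  by apply/negPn/negP => ncw; apply: h; exists v, w.
have nv : ~~ isolated v by rewrite -(nonisolated_connect Bv).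
have iw : isolated w.
  apply: contraNT nBw => nw; apply: connect_trans Bv _.
  exact: (nonisolated_adjacent_connect tD).
have wc : adjacent w c.
  by apply: (isolated_adjacent_connect tD iw (a := v)); [rewrite adjacentC | rewrite csym].
have mw : mixed w by apply: contraT => /(unmixed_far w iw); rewrite adjacentC wc.
have [_ [a [b [ab aw wb]]]] := mixedP _ mw.
have ac : same a c := mixed_connect tD iw ab aw wb wc nc.
have nbrs u : adjacent w u -> same c u.
  move=> wu; have [iu|nu] := boolP (isolated u); last first.
    rewrite csym in ac; apply: connect_trans ac _.
    exact: (mixed_connect tD iw ab aw wb wu nu).
  have uc : adjacent u c.
    have na : ~~ isolated a by apply/isolatedPn; exists b.
    have nb : ~~ isolated b by apply/isolatedPn; exists a; rewrite digonC.
    case/orP: wu => [wu|uw].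
      apply: (isolated_adjacent_connect tD iu (a := b)).
        by apply: (tame_out tD wu (to_arc wb)); apply: contraNneq nb => <-.
      by apply: connect_trans ac; apply: connect1; rewrite digonC.
    apply: (isolated_adjacent_connect tD iu (a := a)) => //.
    by apply: (tame_in tD uw (to_arc aw)); apply: contraNneq na => <-.
  have /mixedP[_ [p [q [pq pu uq]]]] : mixed u.
    by apply: contraT => /(unmixed_far u iu); rewrite adjacentC uc.
  have pc : same p c := mixed_connect tD iu pq pu uq uc nc.
  rewrite csym in pc.
  by have := mixed_nonadjacent tD iw iu ab aw wb pq pu uq (connect_trans ac pc); rewrite wu.
exists w => u u'; rewrite !inE (isolated_from _ iw) (isolated_to _ iw) => uw wu' _.
have cu : same c u by apply: nbrs; rewrite adjacentC single_adjacent ?to_single.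
have cu' : same c u' by apply: nbrs; rewrite single_adjacent ?to_single.
rewrite csym in cu; apply/andP.
exact: (through_isolated tD iw uw wu' (connect_trans cu cu')).
Qed.
End Skeleton.

(** * Skeleton paths between nontrivial digon components *)

Section SkeletonPath.
Variables (D : digraph) (tD : tame D).
Implicit Types x y z a b c u v w : D.

Notation same := (connect (@digon D)).
Notation skeleton_arc := (@skeleton_arc D).

Lemma skeleton_path_in x p : path skeleton_arc x p -> p != [::] ->
  {subset x :: p <= skeleton D}.
Proof.
elim: p x => // y p IH x /= /andP[/and3P[Px Py _] rp] _ z.
rewrite in_cons => /orP[/eqP->//|].
by case: p IH rp => [|q p] IH rp; [rewrite inE => /eqP-> | apply: (IH y)].
Qed.

(** In a shortest skeleton path between two vertices on digons, the interior
    vertices are isolated and not mixed, and the path is induced.  A digon neighbour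
    of either end has the same arcs to the interior as that end, and there is no arc
    between the two components: this is a member of F2. *)
Lemma no_skeleton_path c p : path skeleton_arc c p -> p != [::] ->
  ~~ isolated c -> ~~ isolated (last c p) -> False.
Proof.
have csym := @digon_connect_sym D.
have [n] := ubnP (size p); elim: n c p => // n IH c p; rewrite ltnS => pn rp p0 nc nl.
have shorter c' p' : path skeleton_arc c' p' -> p' != [::] -> ~~ isolated c' ->
    ~~ isolated (last c' p') -> size p <= size p'.
  move=> rp' p'0 nc' nl'; rewrite leqNgt; apply/negP => lt.
  exact: (IH c' p' (leq_trans lt pn)).
have acyc := skeleton_acyclic tD.
have up := acyclic_uniq acyc rp.
have inP := skeleton_path_in rp p0.
have arcs := shortest_path_arcs acyc rp.
have {}arcs : forall a b, a \in c :: p -> b \in c :: p -> to a b = ((a, b) \in zip (c :: p) p).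
  move=> a b La Lb; rewrite -arcs //; first by rewrite /skeleton_arc !inP.
  move=> p' rp' lE; apply: (shorter c p') => //; last by rewrite lE.
  apply: contraTneq (acyclic_path acyc rp p0) => p'E.
  by rewrite -lE p'E /= eqxx.
case/lastP: p p0 rp nl shorter up inP arcs {pn} => // q w1 _.
rewrite rcons_path last_rcons => /andP[rq rw1] nw shorter up inP arcs.
have Pc : c \in skeleton D by apply: inP; rewrite mem_head.
have Pw : w1 \in skeleton D by apply: inP; rewrite in_cons mem_rcons mem_head orbT.
have c_neq_w : c != w1 by apply: contraTneq up => ->; rewrite /= mem_rcons mem_head.
have cw z : same c z -> ~~ same z w1.
  move=> cz; apply: contraNN c_neq_w => zw.
  by apply/eqP/(skeleton_same Pc Pw)/(connect_trans cz zw).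
case: q rq rw1 shorter up inP arcs => [|u1 us].
  move=> _ /and3P[_ _ /to_single/single_adjacent] cw1.
  have := cw c (connect0 _ _).
  by rewrite (nonisolated_adjacent_connect tD).
set q := u1 :: us => rq rw1 shorter up inP arcs.
have iq x : x \in q -> isolated x.
  move=> xq; apply: contraT => nx.
  have q0 : q = u1 :: us by [].
  clearbody q; case/splitPr: xq rq shorter {rw1 up inP arcs q0} => p1 p2.
  rewrite -cat_rcons cat_path => /andP[rp1 _] /(_ c (rcons p1 x) rp1).
  rewrite last_rcons -size_eq0 !size_rcons size_cat size_rcons addSn ltnS => /(_ isT nc nx).
  by rewrite ltnNge leq_addr.
have mq x : x \in q -> ~~ mixed x.
  move=> xq; have /skeletonP[] // : x \in skeleton D.
  by apply: inP; rewrite in_cons mem_rcons in_cons xq !orbT.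
have [v2 cv] := isolatedPn _ nc; have [w2 ww] := isolatedPn _ nw.
have sv : same c v2 := connect1 cv.
have sw : same w1 w2 := connect1 ww.
have nv2 : ~~ isolated v2 by rewrite -(nonisolated_connect sv).
have nw2 : ~~ isolated w2 by rewrite -(nonisolated_connect sw).
have ncw a b : same c a -> same w1 b -> ~~ same a b.
  move=> ca wb; apply: contraNN (cw a ca) => ab.
  by rewrite csym in wb; apply: connect_trans ab wb.
have {}arcs a b : a \in c :: rcons q w1 -> b \in c :: rcons q w1 ->
    to a b = ((a, b) \in (c, u1) :: zip q us ++ [:: (last u1 us, w1)]).
  by move=> La Lb; rewrite arcs // zip_rcons_path.
have Lq x : x \in q -> x \in c :: rcons q w1.
  by move=> xq; rewrite in_cons mem_rcons in_cons xq !orbT.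
have Lc : c \in c :: rcons q w1 by rewrite mem_head.
have Lw : w1 \in c :: rcons q w1 by rewrite in_cons mem_rcons mem_head orbT.
have uk_q : last u1 us \in q by rewrite mem_last.
have nq x : x \in q -> forall y, ~~ isolated y -> (x == y) = false.
  by move=> /iq ix y; apply: contraNF => /eqP<-.
have zipq a b : (a, b) \in zip q us -> (a \in q) /\ (b \in q).
  move=> /mem_zip_path[p1 [p2 [usE <-]]]; rewrite /q usE.
  by rewrite -cat_cons !mem_cat mem_last mem_head orbT.
(* The next four facts are the arcs that meet the interior q; [a] stands for an end
   of the path or for its digon neighbour. *)
have cE a x : same c a -> x \in q -> to a x = (x == u1).
  move=> ca xq; have -> : to a x = to c x.
    rewrite csym in ca.
    apply/idP/idP; last rewrite csym in ca; exact: (unmixed_from tD (iq x xq) (mq x xq)).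
  rewrite arcs ?(Lq x xq) // in_cons mem_cat mem_seq1 !xpair_eqE eqxx /=.
  rewrite (nq x xq w1 nw) andbF orbF; case: eqP => //= _.
  by apply/negbTE/negP => /zipq[/iq]; rewrite (negPf nc).
have Ec a x : same c a -> x \in q -> to x a = false.
  move=> ca xq; apply/negP => xa; rewrite csym in ca.
  have := unmixed_to tD (iq x xq) (mq x xq) ca xa.
  rewrite arcs ?(Lq x xq) // in_cons mem_cat mem_seq1 !xpair_eqE (nq x xq c nc) /=.
  rewrite (negPf c_neq_w) andbF orbF => /zipq[_ /iq].
  by rewrite (negPf nc).
have Ew a x : same w1 a -> x \in q -> to x a = (x == last u1 us).
  move=> wa xq; have -> : to x a = to x w1.
    rewrite csym in wa.
    apply/idP/idP; last rewrite csym in wa; exact: (unmixed_to tD (iq x xq) (mq x xq)).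
  rewrite arcs ?(Lq x xq) // in_cons mem_cat mem_seq1 !xpair_eqE eqxx (nq x xq c nc) /= andbT.
  case: eqP => [|_]; rewrite ?orbT // orbF.
  by apply/negbTE/negP => /zipq[_ /iq]; rewrite (negPf nw).
have wE a x : same w1 a -> x \in q -> to a x = false.
  move=> wa xq; apply/negP => ax; rewrite csym in wa.
  have := unmixed_from tD (iq x xq) (mq x xq) wa ax.
  rewrite arcs ?(Lq x xq) // in_cons mem_cat mem_seq1 !xpair_eqE.
  rewrite (eq_sym w1) (negPf c_neq_w) (nq x xq w1 nw) andbF orbF /= => /zipq[/iq].
  by rewrite (negPf nw).
have qE x y : x \in q -> y \in q -> to x y = ((x, y) \in zip q us).
  move=> xq yq; rewrite arcs ?Lq // in_cons mem_cat mem_seq1 !xpair_eqE.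
  by rewrite (nq x xq c nc) (nq y yq w1 nw) andbF orbF.
have u1q : u1 \in q by rewrite mem_head.
have qn x z : x \in q -> ~~ isolated z -> ((x == z) = false) * ((z == x) = false).
  by move=> xq nz; split; [|rewrite eq_sym]; apply: nq.
have zipNl a b : ~~ isolated a -> ((a, b) \in zip q us) = false.
  by move=> na; apply/negP => /zipq[/iq]; rewrite (negPf na).
have zipNr a b : ~~ isolated b -> ((a, b) \in zip q us) = false.
  by move=> nb; apply/negP => /zipq[_ /iq]; rewrite (negPf nb).
have same_neq a b : same c a -> same w1 b ->
    [/\ (a == b) = false, (b == a) = false, arc a b = false & arc b a = false].
  move=> ca wb; have nab := ncw a b ca wb.
  have na : ~~ isolated a by rewrite -(nonisolated_connect ca).
  have nb : ~~ isolated b by rewrite -(nonisolated_connect wb).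
  have /norP[/negbTE-> /negbTE->] : ~~ adjacent a b.
    by apply: contra nab; apply: nonisolated_adjacent_connect.
  by rewrite (eq_sym b); case: eqP nab => // ->; rewrite connect0.
have [cw1 w1c acw1 aw1c] := same_neq c w1 (connect0 _ _) (connect0 _ _).
have [cw2 w2c acw2 aw2c] := same_neq c w2 (connect0 _ _) sw.
have [vw1 w1v avw1 aw1v] := same_neq v2 w1 sv (connect0 _ _).
have [vw2 w2v avw2 aw2v] := same_neq v2 w2 sv sw.
have c_v2 := negbTE (digon_neq cv); have v2_c : (v2 == c) = false by rewrite eq_sym.
have w1_w2 := negbTE (digon_neq ww); have w2_w1 : (w2 == w1) = false by rewrite eq_sym.
have [acv avc] := andP cv; have [aww aww'] := andP ww.
have qnE x : x \in q ->
    (((x == c = false) * (c == x = false)) * ((x == v2 = false) * (v2 == x = false))) *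
    (((x == w1 = false) * (w1 == x = false)) * ((x == w2 = false) * (w2 == x = false))).
  by move=> xq; rewrite !(qn x _ xq).
have endsE := (acw1, aw1c, acw2, aw2c, avw1, aw1v, avw2, aw2v, acv, avc, aww, aww', @arcxx D).
have neqE := (cw1, w1c, cw2, w2c, vw1, w1v, vw2, w2v, c_v2, v2_c, w1_w2, w2_w1,
  qnE _ u1q, qnE _ uk_q, eqxx).
have zipE := (fun b => zipNl c b nc, fun b => zipNl v2 b nv2,
  fun b => zipNl w1 b nw, fun b => zipNl w2 b nw2,
  fun b => zipNr b c nc, fun b => zipNr b v2 nv2,
  fun b => zipNr b w1 nw, fun b => zipNr b w2 nw2).
apply: (@tame_F2 D tD c v2 u1 us w1 w2) => [|x y]; rewrite -/q.
  have notus z : ~~ isolated z -> (z \in us) = false.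
    by move=> nz; apply: contraNF nz => zus; apply: iq; rewrite in_cons zus orbT.
  have uq : uniq q by move: up; rewrite cons_uniq rcons_uniq => /and3P[].
  rewrite cat_uniq has_sym cat_uniq uq /= !in_cons !mem_cat !in_cons !in_nil !neqE /=.
  by rewrite !notus.
have classify z : z \in [:: c; v2] ++ q ++ [:: w1; w2] ->
    [\/ z = c \/ z = v2, z \in q | z = w1 \/ z = w2].
  rewrite !mem_cat !mem_seq2 => /or3P[/orP[]/eqP->|zq|/orP[]/eqP->].
  - by constructor 1; left.
  - by constructor 1; right.
  - by constructor 2.
  - by constructor 3; left.
  - by constructor 3; right.
have toE a x' : x' \in q -> (arc a x' = to a x') * (arc x' a = to x' a).
  by move=> /iq ix; split; [apply: isolated_from | apply: isolated_to].
move=> /classify[xc|xq|xw] /classify[yc|yq|yw].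
- by case: xc => ->; case: yc => ->; rewrite ?endsE !inE mem_cat !inE !xpair_eqE ?neqE ?zipE.
- by case: xc => ->; rewrite (toE _ _ yq) (cE _ _ _ yq) //
       !inE mem_cat !inE !xpair_eqE !(qnE _ yq) ?neqE ?zipE /= ?andbF ?orbF.
- by case: xc => ->; case: yw => ->; rewrite ?endsE !inE mem_cat !inE !xpair_eqE ?neqE ?zipE.
- by case: yc => ->; rewrite (toE _ _ xq) (Ec _ _ _ xq) //
       !inE mem_cat !inE !xpair_eqE !(qnE _ xq) ?neqE ?zipE /= ?andbF ?orbF.
- by rewrite (toE _ _ xq) (qE _ _ xq yq)
       !inE mem_cat !inE !xpair_eqE !(qnE _ xq) !(qnE _ yq) /= !andbF /= orbF.
- by case: yw => ->; rewrite (toE _ _ xq) (Ew _ _ _ xq) //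
       !inE mem_cat !inE !xpair_eqE !(qnE _ xq) ?neqE ?zipE /= ?andbF ?orbF ?andbT.
- by case: xw => ->; case: yc => ->; rewrite ?endsE !inE mem_cat !inE !xpair_eqE ?neqE ?zipE.
- by case: xw => ->; rewrite (toE _ _ yq) (wE _ _ _ yq) //
       !inE mem_cat !inE !xpair_eqE !(qnE _ yq) ?neqE ?zipE /= ?andbF ?orbF.
by case: xw => ->; case: yw => ->; rewrite ?endsE !inE mem_cat !inE !xpair_eqE ?neqE ?zipE.
Qed.
End SkeletonPath.

(** * A good vertex *)

Lemma tame_good (D : digraph) (tD : tame D) :
  exists v : D, semi_strict_di_simplicial v.
Proof.
have acyc := skeleton_acyclic tD.
have [s Ps src] := acyclic_source acyc (skeleton_nonempty D).
have [is_|ns] := boolP (isolated s).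
  exists s => u w; rewrite !inE (isolated_from _ is_).
  move=> /(skeleton_in tD Ps is_)[y' ry']; have /and3P[Py' _ _] := ry'.
  by rewrite (negPf (src y' Py')) in ry'.
have [[y Py sy]|far] := classic (exists2 y, y \in skeleton D & adjacent s y); last first.
  apply: (isolated_rep_good tD Ps ns) => y Py.
  by apply/negP => sy; apply: far; exists y.
have rsy : skeleton_arc s y.
  rewrite /skeleton_arc Ps Py /=; move: sy; rewrite adjacentE single_arcE.
  case/or3P=> // [sy|ys].
    by move: (digon_neq sy); rewrite (skeleton_same Ps Py (connect1 sy)) eqxx.
  by have := src y Py; rewrite /skeleton_arc Py Ps ys.
pose W := [set t | connect (@skeleton_arc D) s t].
have W0 : W != set0 by apply/set0Pn; exists s; rewrite inE connect0.
have [t] := acyclic_sink acyc W0; rewrite inE => /connectP[p rp tE] snk.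
have p0 : p != [::].
  apply: contraTneq (rsy) => p0; rewrite p0 /= in tE; rewrite -tE.
  by apply: snk; rewrite inE connect1.
have Pt : t \in skeleton D.
  by rewrite tE; apply: (skeleton_path_in rp p0); apply: mem_last.
have [it|nt] := boolP (isolated t); last first.
  by rewrite tE in nt; case: (no_skeleton_path tD rp p0 ns nt).
exists t => u w _; rewrite inE (isolated_to _ it).
move=> /(skeleton_out tD Pt it)[y' ry'].
suff Wy' : y' \in W by move: (snk y' Wy'); rewrite ry'.
rewrite inE; apply: connect_trans _ (connect1 ry').
by apply/connectP; exists p.
Qed.

(** * The obstructions have no semi-strict di-simplicial vertex *)

Section Bad.
Variable H : digraph.
Implicit Types u v w x y : H.

Lemma violation_not_good u v w : violation u v w -> ~ semi_strict_di_simplicial v.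
Proof.
case/and4P=> uv vw uw /negP nuw /(_ u w); rewrite !inE => /(_ uv vw uw) good.
exact/nuw/andP.
Qed.

(** The vertex a is both an in- and an out-neighbour of v, so the direction of the
    arc between v and b does not matter. *)
Lemma single_not_good v a b : digon v a -> adjacent v b -> single_arc a b ->
  ~ semi_strict_di_simplicial v.
Proof.
move=> /andP[va av] /orP[vb|bv] sab.
  by apply: (@violation_not_good a v b); rewrite /violation av vb single_neq ?single_Ndigon.
rewrite single_arcC in sab.
by apply: (@violation_not_good b v a); rewrite /violation va bv single_neq ?single_Ndigon.
Qed.

Lemma transitive_not_good u v w : to u v -> to v w -> single_arc u w ->
  ~ semi_strict_di_simplicial v.
Proof.
move=> uv vw suw; apply: (@violation_not_good u v w).
by rewrite /violation (to_arc uv) (to_arc vw) single_neq ?single_Ndigon.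
Qed.

Lemma lists_vertices_mem (s : seq H) v : lists_vertices s -> v \in s.
Proof. by move=> /perm_mem->; rewrite mem_enum. Qed.

Lemma lists_vertices_uniq (s : seq H) : lists_vertices s -> uniq s.
Proof. by move=> /perm_uniq->; apply: enum_uniq. Qed.

Lemma cycle_not_good v : nonsymmetric_directed_cycle H -> ~ semi_strict_di_simplicial v.
Proof.
case=> -[s [ls _ arcs]] nsym; have us := lists_vertices_uniq ls.
have uv : arc (prev s v) v by rewrite arcs next_prev.
have vw : arc v (next s v) by rewrite arcs.
apply: (@violation_not_good (prev s v) v (next s v)); rewrite /violation uv vw /=.
apply/andP; split; first by apply: contraTneq vw => <-; apply: nsym.
by apply/negP => /andP[/nsym/negP].
Qed.

Lemma F1_not_good v : F1 H -> ~ semi_strict_di_simplicial v.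
Proof.
case=> [] [x1 [x2 [x3]]].
- case=> x4 [/(lists_vertices_mem v) + /and4P[d13 d24 s12 /and3P[s34 a23 a41]]].
  rewrite !inE => /or4P[] /eqP->.
  + by apply: (@single_not_good _ x3 x4); rewrite // adjacentC.
  + by apply: (@single_not_good _ x4 x3); rewrite // single_arcC.
  + by apply: (@single_not_good _ x1 x2); rewrite // (digonC, adjacentC).
  + by apply: (@single_not_good _ x2 x1); rewrite // (digonC, single_arcC).
- case=> x4 [/(lists_vertices_mem v) + /and4P[d14 d13 t23 /and3P[t43 t42 s12]]].
  rewrite !inE => /or4P[] /eqP->.
  + by apply: (@single_not_good _ x3 x4); rewrite ?digon_adjacent // single_arcC to_single.
  + by apply: (@transitive_not_good x4 _ x3); rewrite ?to_single.
  + apply: (@single_not_good _ x1 x2); rewrite // 1?digonC //.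
    by rewrite adjacentC single_adjacent ?to_single.
  + by apply: (@single_not_good _ x1 x2); rewrite // 1?digonC // single_adjacent ?to_single.
- case=> x4 [/(lists_vertices_mem v) + /and4P[d34 t23 t41 /and3P[t13 t42 s12]]].
  have s21 : single_arc x2 x1 by rewrite single_arcC.
  rewrite !inE => /or4P[] /eqP->.
  + move: (s12); rewrite single_arcE => /orP[t12|t21].
      by apply: (@transitive_not_good x4 _ x2); rewrite ?to_single.
    by apply: (@transitive_not_good x2 _ x3); rewrite ?to_single.
  + move: (s12); rewrite single_arcE => /orP[t12|t21].
      by apply: (@transitive_not_good x1 _ x3); rewrite ?to_single.
    by apply: (@transitive_not_good x4 _ x1); rewrite ?to_single.
  + apply: (@single_not_good _ x4 x2); rewrite ?to_single //.
    by rewrite adjacentC single_adjacent ?to_single.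
  + apply: (@single_not_good _ x3 x1); rewrite 1?digonC //.
      by rewrite single_adjacent ?to_single.
    by rewrite single_arcC to_single.
case=> /(lists_vertices_mem v) + /and3P[t12 t23 t31].
rewrite !inE => /or3P[] /eqP->.
+ by apply: (@transitive_not_good x3 _ x2); rewrite // single_arcC to_single.
+ by apply: (@transitive_not_good x1 _ x3); rewrite // single_arcC to_single.
by apply: (@transitive_not_good x2 _ x1); rewrite // single_arcC to_single.
Qed.

(** Exchanging v1 with v2 and w1 with w2 preserves F2, so these vertices v cover all
    cases.  Around each of them, a violation is found on the induced path from v2
    to w1, on which an arc always leads to the next vertex. *)
Lemma F2_not_good_ends v1 v2 u1 us w1 w2 v :
  uniq ([:: v1; v2] ++ (u1 :: us) ++ [:: w1; w2]) ->
  (forall x y, arc x y = ((x, y) \in F2_arcs v1 v2 u1 us w1 w2)) ->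
  v \in [:: v1, w2, u1 & us] -> ~ semi_strict_di_simplicial v.
Proof.
set q := u1 :: us => us_ arcs.
pose p := rcons q w1.
have zipE : zip (v2 :: p) p = (v2, u1) :: zip q us ++ [:: (last u1 us, w1)].
  by rewrite zip_rcons_path.
have us' : uniq ([:: v1, w2, v2 & p]).
  suff /perm_uniq-> : perm_eq [:: v1, w2, v2 & p] ([:: v1; v2] ++ q ++ [:: w1; w2]) by [].
  apply/permP => P; rewrite /p -cats1 /= !count_cat /= !addn0; congr (_ + _).
  by rewrite (addnC (P w2)) -!addnA.
have /and3P[v1p w2p up'] := us'; have up : uniq (v2 :: p) by [].
have arc_zip x y : (x, y) \in zip (v2 :: p) p -> arc x y.
  rewrite arcs zipE /F2_arcs !inE !mem_cat !inE.
  by case/or3P=> ->; rewrite ?orbT.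
have zip_arc x y : x \in v2 :: p -> y \in v2 :: p -> arc x y -> (x, y) \in zip (v2 :: p) p.
  move=> xp yp; rewrite arcs zipE /F2_arcs !inE !mem_cat !inE !xpair_eqE.
  have xv1 : (x == v1) = false by apply: contraNF v1p => /eqP<-; rewrite in_cons xp orbT.
  have yv1 : (y == v1) = false by apply: contraNF v1p => /eqP<-; rewrite in_cons yp orbT.
  have xw2 : (x == w2) = false by apply: contraNF w2p => /eqP<-.
  have yw2 : (y == w2) = false by apply: contraNF w2p => /eqP<-.
  by rewrite xv1 yv1 xw2 yw2 ?andbF /= !orbF.
have step x y : x \in v2 :: p -> y \in v2 :: p -> arc x y ->
    index y (v2 :: p) = (index x (v2 :: p)).+1.
  by move=> xp yp /(zip_arc _ _ xp yp)/(index_zip_path up).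
have consecutive x y z : x \in v2 :: p -> y \in v2 :: p -> z \in v2 :: p ->
    arc x y -> arc y z -> ~ semi_strict_di_simplicial y.
  move=> xp yp zp xy yz; have xyE := step x y xp yp xy; have yzE := step y z yp zp yz.
  apply: (@violation_not_good x y z); rewrite /violation xy yz /=; apply/andP; split.
    by apply/eqP => xz; move: yzE; rewrite -xz xyE => /eqP; rewrite ltn_eqF.
  apply/negP => /andP[/(step x z xp zp) + _]; rewrite yzE xyE => /eqP.
  by rewrite eqSS gtn_eqF.
have qp x : x \in q -> x \in v2 :: p by move=> xq; rewrite /p in_cons mem_rcons in_cons xq !orbT.
have v2p : v2 \in v2 :: p by rewrite mem_head.
have u1p : u1 \in v2 :: p by rewrite qp ?mem_head.
have w1p : w1 \in v2 :: p by rewrite /p in_cons mem_rcons mem_head orbT.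
have back x y : x \in v2 :: p -> y \in v2 :: p -> arc x y -> ~~ digon x y.
  move=> xp yp xy; apply/negP => /andP[_ /(step y x yp xp)]; rewrite (step x y xp yp xy).
  by move/eqP; rewrite ltn_eqF.
rewrite !in_cons => /or3P[/eqP->|/eqP->|vq].
- have v2u1 : arc v2 u1 by apply: arc_zip; rewrite zipE mem_head.
  apply: (@violation_not_good v2 v1 u1); rewrite /violation (back _ _ v2p u1p v2u1) andbT.
  rewrite !arcs /F2_arcs !inE !eqxx !orbT /=.
  by apply: contraTneq up => ->; rewrite /= mem_rcons !inE eqxx orbT.
- have ukp : last u1 us \in v2 :: p by rewrite qp ?mem_last.
  have ukw1 : arc (last u1 us) w1 by apply: arc_zip; rewrite zipE in_cons mem_cat mem_head !orbT.
  apply: (@violation_not_good (last u1 us) w2 w1); rewrite /violation (back _ _ ukp w1p ukw1) andbT.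
  rewrite !arcs /F2_arcs !inE !mem_cat !inE !eqxx !orbT /=.
  by apply: contraTneq up => ukE; rewrite cons_uniq rcons_uniq -ukE mem_last !andbF.
have {}vq : v \in q by rewrite in_cons.
have vp := qp v vq.
suff [x [z [xv vz]]] : exists x z, (x, v) \in zip (v2 :: p) p /\ (v, z) \in zip (v2 :: p) p.
  apply: (consecutive x v z) => //; try exact: arc_zip.
    by case/mem_zip_path: xv => p1 [p2 [-> <-]]; rewrite -cat_cons mem_cat mem_last.
  by case/mem_zip_path: vz => p1 [p2 [-> _]]; rewrite in_cons mem_cat mem_head !orbT.
rewrite /p; move: (q) vq => l vl; case/splitPr: vl => p1 p2.
exists (last v2 p1), (head w1 p2); split; apply/mem_zip_path.
  by exists p1, (rcons p2 w1); rewrite rcons_cat.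
exists (rcons p1 v), (behead (rcons p2 w1)); rewrite last_rcons rcons_cat cat_rcons; split=> //.
by case: p2.
Qed.

Lemma F2_not_good v : F2 H -> ~ semi_strict_di_simplicial v.
Proof.
case=> [v1 [v2 [u1 [us [w1 [w2 [ls arcs]]]]]]].
have vs := lists_vertices_mem v ls; have us_ := lists_vertices_uniq ls.
have : (v \in [:: v1, w2, u1 & us]) || (v \in [:: v2, w1, u1 & us]).
  move: vs; rewrite !mem_cat !inE => /or3P[/orP[]->|->|/orP[]->]; by rewrite /= ?orbT.
case/orP; first exact: F2_not_good_ends us_ arcs.
apply: (@F2_not_good_ends v2 v1 u1 us w2 w1).
  suff /perm_uniq-> : perm_eq ([:: v2; v1] ++ (u1 :: us) ++ [:: w2; w1])
    ([:: v1; v2] ++ (u1 :: us) ++ [:: w1; w2]) by [].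
  have swap2 (a b : H) : perm_eq [:: a; b] [:: b; a].
    by apply/permP => P /=; rewrite addnCA.
  by apply: perm_cat; rewrite ?swap2 //; apply: perm_cat; rewrite ?swap2.
have swap4 (T : eqType) (a b c d : T) : perm_eq [:: a; b; c; d] [:: b; a; d; c].
  apply/permP => P /=; rewrite addnCA; congr (_ + (_ + _)); exact: addnCA.
move=> x y; rewrite arcs; apply: perm_mem; apply: perm_cat; first exact: swap4.
by apply: perm_cat; rewrite ?swap4.
Qed.
End Bad.

(** * Induced subdigraphs are unobstructed *)

Section Transfer.
Variables (D : digraph) (hD : locally_semicomplete D).

Lemma locally_semicomplete_in (v u w : D) :
  arc u v -> arc w v -> u != w -> adjacent u w.
Proof.
move=> uv wv uw; have uN : u \in in_nbh v by rewrite inE.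
have wN : w \in in_nbh v by rewrite inE.
have N0 : in_nbh v != set0 by apply/set0Pn; exists u.
exact: (((hD v).1 N0) (Sub u uN : induced N0) (Sub w wN : induced N0) uw).
Qed.

Lemma locally_semicomplete_out (v u w : D) :
  arc v u -> arc v w -> u != w -> adjacent u w.
Proof.
move=> uv wv uw; have uN : u \in out_nbh v by rewrite inE.
have wN : w \in out_nbh v by rewrite inE.
have N0 : out_nbh v != set0 by apply/set0Pn; exists u.
exact: (((hD v).2 N0) (Sub u uN : induced N0) (Sub w wN : induced N0) uw).
Qed.

Variables (A : {set D}) (hA : A != set0).
Let H := induced hA.

(** An induced subdigraph of D[A] is one of D, up to the type of its vertices. *)
Lemma induced_copy (s : seq H) : s != [::] -> uniq s ->
  exists (B : {set D}) (hB : B != set0) (f : H -> induced hB),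
    lists_vertices (map f s) /\ {in s, forall x, val (f x) = val x}.
Proof.
case: s => // x0 s' _; set s := x0 :: s' => us.
pose B := [set val x | x in s].
have valB x : x \in s -> val x \in B by move=> sx; apply: imset_f.
have hB : B != set0 by apply/set0Pn; exists (val x0); rewrite valB ?mem_head.
pose d0 : induced hB := Sub (val x0) (valB x0 (mem_head _ _)).
pose f (x : H) : induced hB := insubd d0 (val x).
have valf : {in s, forall x, val (f x) = val x}.
  by move=> x sx; rewrite /f insubdK // valB.
exists B, hB, f; split=> //.
apply: uniq_perm; rewrite ?enum_uniq //.
  by rewrite map_inj_in_uniq // => x y sx sy fE; apply: val_inj; rewrite -!valf // fE.
move=> y; rewrite mem_enum; apply: (introT mapP).
have /imsetP[x sx yE] := valP y.
by exists x => //; apply: val_inj; rewrite valf.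
Qed.

(** How the absence of a family in D is used: [K] is the subdigraph induced on s, and
    only the isomorphism f from s to it is needed to show that it belongs to F. *)
Lemma free_induced (F : digraph -> Prop) (s : seq H) : ~ contains_induced F D ->
  s != [::] -> uniq s ->
  (forall (K : digraph) (f : H -> K), lists_vertices (map f s) ->
    {in s &, injective f} -> {in s &, forall x y, arc (f x) (f y) = arc x y} -> F K) ->
  False.
Proof.
move=> nF s0 us hF; have [B [hB [f [lf valf]]]] := induced_copy s0 us.
apply: nF; exists B, hB; apply: (hF _ f) => // x y sx sy.
  by move=> fE; apply: val_inj; rewrite -!valf // fE.
by rewrite [LHS]/(arc (val (f x)) (val (f y))) !valf.
Qed.

Lemma tame_induced : semi_strict_chordal (symmetric_part D) ->
  ~ contains_induced nonsymmetric_directed_cycle D ->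
  ~ contains_induced F1 D -> ~ contains_induced F2 D -> tame H.
Proof.
move=> chS ncyc nF1 nF2.
have mem4 (a b c d : H) : [/\ a \in [:: a; b; c; d], b \in [:: a; b; c; d],
    c \in [:: a; b; c; d] & d \in [:: a; b; c; d]].
  by rewrite !inE !eqxx !orbT.
split.
- by move=> v u w uv wv uw; apply: (locally_semicomplete_in uv wv).
- by move=> v u w uv wv uw; apply: (locally_semicomplete_out uv wv).
- move=> a b c d ac bd sab scd bc da.
  apply: (@free_induced F1 [:: a; b; c; d]) => //.
    rewrite /= !inE !negb_or (digon_neq ac) (digon_neq bd) (single_neq sab).
    by rewrite (single_neq scd) (adjacent_neq bc) eq_sym (adjacent_neq da).
  move=> K f lf _ fE; have [sa sb sc sd] := mem4 a b c d.
  constructor 1; exists (f a), (f b), (f c), (f d); split=> //.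
  by rewrite /digon /single_arc /adjacent !fE //; apply/and4P; split=> //; apply/and3P.
- move=> a b c d ad ac bc dc db sab.
  apply: (@free_induced F1 [:: a; b; c; d]) => //.
    rewrite /= !inE !negb_or (single_neq sab) (digon_neq ac) (digon_neq ad).
    by rewrite (to_neq bc) (eq_sym b d) (to_neq db) (eq_sym c) (to_neq dc).
  move=> K f lf _ fE; have [sa sb sc sd] := mem4 a b c d.
  constructor 2; exists (f a), (f b), (f c), (f d); split=> //.
  by rewrite /digon /single_arc /to !fE //; apply/and4P; split=> //; apply/and3P.
- move=> a b c d cd bc da ac db sab.
  apply: (@free_induced F1 [:: a; b; c; d]) => //.
    rewrite /= !inE !negb_or (single_neq sab) (to_neq ac) (eq_sym a d) (to_neq da).
    by rewrite (to_neq bc) (eq_sym b d) (to_neq db) (digon_neq cd).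
  move=> K f lf _ fE; have [sa sb sc sd] := mem4 a b c d.
  constructor 3; exists (f a), (f b), (f c), (f d); split=> //.
  by rewrite /digon /single_arc /to !fE //; apply/and4P; split=> //; apply/and3P.
- move=> a b c ab bc ca.
  apply: (@free_induced F1 [:: a; b; c]) => //.
    by rewrite /= !inE !negb_or (to_neq ab) (to_neq bc) eq_sym (to_neq ca).
  move=> K f lf _ fE.
  constructor 4; exists (f a), (f b), (f c); split=> //.
  by rewrite /to !fE ?inE ?eqxx ?orbT //; apply/and3P.
- move=> B /set0Pn[b0 Bb0]; pose C : {set symmetric_part D} := [set val x | x in B].
  have valC x : x \in B -> val x \in C by move=> Bx; apply: imset_f.
  have hC : C != set0 by apply/set0Pn; exists (val b0); apply: valC.
  have [v good_v] := chS C hC; have /imsetP[v0 Bv0 vE] := valP v.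
  exists v0 => // u w Bu Bw vu vw uw.
  pose u' : induced hC := Sub (val u) (valC u Bu).
  pose w' : induced hC := Sub (val w) (valC w Bw).
  have [] // := good_v u' w'.
    rewrite inE -[arc _ _]/(@digon D (val u) (val v)) vE.
    by rewrite -[digon _ _]/(digon u v0) digonC.
  by rewrite inE -[arc _ _]/(@digon D (val v) (val w)) vE.
- move=> s s1 us arcs nd.
  apply: (@free_induced _ s ncyc _ us); first by case: s s1 {us arcs nd}.
  move=> K f lf injf fE.
  have sf (y : K) : exists2 x, x \in s & y = f x.
    by have := lists_vertices_mem y lf => /mapP.
  split; last first.
    move=> y z; have [x sx ->] := sf y; have [t st ->] := sf z.
    by rewrite !fE // => xt; have := nd x t sx st; rewrite /digon xt.
  exists (map f s); split; rewrite ?size_map //.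
  move=> y z; have [x sx ->] := sf y; have [t st ->] := sf z.
  rewrite fE // arcs // next_map_in //; apply/eqP/eqP => [->//|].
  by apply: injf; rewrite ?mem_next.
- move=> v1 v2 u1 us w1 w2 s us_ arcs.
  apply: (@free_induced _ s nF2 _ us_) => //.
  move=> K f lf injf fE.
  exists (f v1), (f v2), (f u1), (map f us), (f w1), (f w2); split.
    by move: lf; rewrite /s !map_cat.
  pose Z := F2_arcs v1 v2 u1 us w1 w2.
  have Zs a b : (a, b) \in Z -> a \in s /\ b \in s.
    have q_s x : x \in u1 :: us -> x \in s by move=> xq; rewrite !mem_cat xq orbT.
    have [v1s v2s w1s w2s] : [/\ v1 \in s, v2 \in s, w1 \in s & w2 \in s].
      by rewrite !mem_cat !inE !eqxx !orbT.
    have u1s : u1 \in s by rewrite q_s ?mem_head.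
    have uks : last u1 us \in s by rewrite q_s ?mem_last.
    rewrite mem_cat => /orP[h|].
      by rewrite !inE in h; case/or4P: h => /eqP[-> ->].
    rewrite mem_cat => /orP[/mem_zip_path[p1 [p2 [usE <-]]]|h].
    - split; apply: (q_s); rewrite usE -cat_cons mem_cat; first by rewrite mem_last.
      by rewrite mem_head orbT.
    - by rewrite !inE in h; case/or4P: h => /eqP[-> ->].
  move=> y z; have /mapP[x sx ->] := lists_vertices_mem y lf.
  have /mapP[t st ->] := lists_vertices_mem z lf.
  rewrite fE // arcs // -/Z last_map.
  pose ff (e : H * H) := (f e.1, f e.2).
  rewrite -[f u1 :: map f us]/(map f (u1 :: us)) zip_map -/ff.
  rewrite -[RHS]/((ff (x, t)) \in _).
  rewrite -[X in X ++ _]/(map ff [:: (v1, v2); (v2, v1); (v1, u1); (v2, u1)]).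
  rewrite -[X in _ ++ (_ ++ X)]/(map ff
    [:: (last u1 us, w1); (last u1 us, w2); (w1, w2); (w2, w1)]).
  rewrite -!map_cat -/Z; apply/idP/mapP => [xtZ|[[a b] abZ [xa tb]]]; first by exists (x, t).
  have [sa sb] := Zs a b abZ.
  by rewrite (injf _ _ sx sa xa) (injf _ _ st sb tb).
Qed.
End Transfer.

Theorem theorem4 (D : digraph) (hD : locally_semicomplete D) :
  semi_strict_chordal D <->
  [/\ semi_strict_chordal (symmetric_part D),
      ~ contains_induced nonsymmetric_directed_cycle D,
      ~ contains_induced F1 D
    & ~ contains_induced F2 D].
Proof.
split=> [chD|[chS ncyc nF1 nF2] A hA]; last first.
  exact: tame_good (tame_induced hD hA chS ncyc nF1 nF2).
split.
- move=> A hA; have [v good_v] := chD A hA; exists v => u w; rewrite !inE.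
  move=> /andP[uv vu] /andP[vw wv] uw.
  have [] := good_v u w; rewrite ?inE // => uw' wu'.
  by split; apply/andP.
- by case=> A [hA FA]; have [v] := chD A hA; apply: cycle_not_good.
- by case=> A [hA FA]; have [v] := chD A hA; apply: F1_not_good.
- by case=> A [hA FA]; have [v] := chD A hA; apply: F2_not_good.
Qed.
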